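(* Let $Y$ be a $p\times q$ random matrix with $Y\sim\mathcal N_{p\times q}(0,\Lambda)$, where $\Lambda$ is a $pq\times pq$ matrix. For $j=1,\dots,m$, let $\kappa_j$ and $\alpha_j$ be nonrandom $p\times p$ matrices, $\iota_j$ and $\beta_j$ nonrandom $q\times q$ matrices, and $\varrho_j$ nonrandom $p\times q$ matrices. Then $$\begin{pmatrix}\kappa_1Y\iota_1+\alpha_1Y\beta_1+\varrho_1\\ \kappa_2Y\iota_2+\alpha_2Y\beta_2+\varrho_2\\ \vdots\\ \kappa_mY\iota_m+\alpha_mY\beta_m+\varrho_m\end{pmatrix}\sim\mathcal N_{mp\times q}\left(\begin{pmatrix}\varrho_1\\ \varrho_2\\ \vdots\\ \varrho_m\end{pmatrix},\begin{pmatrix}A_{11}&A_{12}&\cdots&A_{1m}\\ A_{21}&A_{22}&\cdots&A_{2m}\\ \vdots&\vdots&&\vdots\\ A_{m1}&A_{m2}&\cdots&A_{mm}\end{pmatrix}\right),$$ where $A_{ji}=(A_{ij})'$ for $i,j=1,\dots,m$ and $$A_{ij}=(\kappa_i\otimes\iota_i')\Lambda(\kappa_j'\otimes\iota_j)+(\kappa_i\otimes\iota_i')\Lambda(\alpha_j'\otimes\beta_j)+(\alpha_i\otimes\beta_i')\Lambda(\kappa_j'\otimes\iota_j)+(\alpha_i\otimes\beta_i')\Lambda(\alpha_j'\otimes\beta_j).$$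
   Context: Here $'$ is transpose and $\otimes$ the Kronecker product. For a matrix $A$, $\operatorname{vec}(A)$ denotes the column vector obtained by stacking the rows of $A$ (so $\operatorname{vec}(AYC)=(A\otimes C')\operatorname{vec}(Y)$). A random $a\times b$ matrix $Y$ is $\mathcal N_{a\times b}(\mu,\Omega)$ if $\operatorname{vec}(Y)$ is (possibly degenerate) $ab$-variate normal with mean $\operatorname{vec}(\mu)$ and covariance matrix $\Omega$ (symmetric nonnegative definite). *)

(* Defs.v *)
From mathcomp Require Import all_boot all_order all_algebra.
From mathcomp Require Import mxtens.
From mathcomp Require Import all_classical all_reals all_analysis.

Set Implicit Arguments.
Unset Strict Implicit.
Unset Printing Implicit Defensive.

Import Order.TTheory GRing.Theory Num.Theory.

Local Open Scope ring_scope.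

(* Univariate normal law with mean [m] and standard deviation [s], degenerate
   case included: [normal_prob m 0] is not a Dirac mass in the library. *)
Definition normal_law {R : realType} (m s : R)
    (A : set (measurableTypeR R)) : \bar R :=
  if s == 0 then \d_m A else normal_prob m s A.

Definition is_normal {d : measure_display} {T : measurableType d}
    {R : realType} (P : probability T R) (X : T -> R) : Prop :=
  measurable_fun setT X /\
  exists m s : R, 0 <= s /\
    forall A : set (measurableTypeR R),
      measurable A -> P (X @^-1` A)%classic = normal_law m s A.

Definition nonneg_definite {R : realType} {n : nat} (S : 'M[R]_n) : Prop :=
  S^T = S /\ forall c : 'cV[R]_n, 0 <= (c^T *m S *m c) 0 0.

(* Possibly degenerate [n]-variate normal vector: every linear combination of
   the coordinates is univariate normal, possibly degenerate. *)
Definition normal_vector {d : measure_display} {T : measurableType d}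
    {R : realType} (P : probability T R) {n : nat}
    (X : T -> 'cV[R]_n) (mu : 'cV[R]_n) (S : 'M[R]_n) : Prop :=
  [/\ forall c : 'cV[R]_n, is_normal P (fun w => (c^T *m X w) 0 0),
      forall i, expectation P (fun w => X w i 0) = (mu i 0)%:E,
      forall i j, covariance P (fun w => X w i 0) (fun w => X w j 0)
                  = (S i j)%:E
    & nonneg_definite S].

(* [mxvec] lists the entries row by row. *)
Definition vec {R : Type} {a b : nat} (A : 'M[R]_(a, b)) : 'cV[R]_(a * b) :=
  (mxvec A)^T.

Lemma index_allpairs_pair (S T : eqType) (s : seq S) (t : seq T) x y :
  x \in s -> y \in t ->
  index (x, y) [seq (a, b) | a <- s, b <- t] = (index x s * size t + index y t)%N.
Proof.
move=> + yt; elim: s => //= a s IH; rewrite inE index_cat.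
have pI : injective (pair a : T -> S * T) by move=> ? ? [].
have [-> _|xa /= xs] := eqVneq x a.
  by rewrite (map_f (pair a)) // index_map // mul0n.
rewrite ifN ?size_map ?IH ?addnA // -?mulSn //.
by apply/mapP => -[b _ [xa' _]]; rewrite xa' eqxx in xa.
Qed.

Lemma mxvec_indexE (m n : nat) (i : 'I_m) (j : 'I_n) :
  mxvec_index i j = mxtens_index (i, j).
Proof.
have e : enum {: 'I_m * 'I_n} = [seq (a, b) | a <- enum 'I_m, b <- enum 'I_n].
  by rewrite enumT unlock.
have h : index (i, j) (enum {: 'I_m * 'I_n}) = (i * n + j)%N.
  by rewrite e index_allpairs_pair ?mem_enum // !index_enum_ord size_enum_ord.
apply: val_inj => /=; rewrite -h -{2}(enum_rankK (i, j)).
by rewrite (enum_val_nth (i, j)) index_uniq ?enum_uniq // -?cardE ?ltn_ord.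
Qed.

Lemma vec_mulmx (R : comPzRingType) (p q r s : nat)
    (A : 'M[R]_(p, q)) (Y : 'M[R]_(q, r)) (C : 'M[R]_(r, s)) :
  vec (A *m Y *m C) = (A *t C^T) *m vec Y.
Proof.
apply/colP => k; case/mxvec_indexP: k => i j.
rewrite /vec [LHS]mxE mxvecE !mxE (reindex _ (curry_mxvec_bij q r)) /=.
rewrite [RHS](eq_bigr (fun x => A i x.1 * C x.2 j * Y x.1 x.2)); last first.
  move=> [a b] _ /=.
  by rewrite mxvec_indexE [in X in X * _]mxvec_indexE tensmxE 2!mxE mxvecE.
rewrite -(pair_bigA _ (fun a b => A i a * C b j * Y a b)) /= exchange_big /=.
apply: eq_bigr => l _; rewrite mxE mulr_suml.
by apply: eq_bigr => a _; rewrite mulrAC.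
Qed.

Definition matrix_normal {d : measure_display} {T : measurableType d}
    {R : realType} (P : probability T R) {a b : nat}
    (Y : T -> 'M[R]_(a, b)) (mu : 'M[R]_(a, b)) (Omega : 'M[R]_(a * b)) :
    Prop :=
  normal_vector P (fun w => vec (Y w)) (vec mu) Omega.

Lemma sum_ord_const (m n : nat) : (\sum_(i < m) n = m * n)%N.
Proof. by rewrite sum_nat_const card_ord. Qed.

Lemma sum_ord_constM (m p q : nat) : (\sum_(i < m) p * q = m * p * q)%N.
Proof. by rewrite sum_ord_const mulnA. Qed.

Definition stack_mx {R : Type} {m p q : nat} (B : 'I_m -> 'M[R]_(p, q)) :
    'M[R]_(m * p, q) :=
  castmx (sum_ord_const m p, erefl q) (\mxcol_(i < m) B i).

Definition blocks_mx {R : Type} {m p q : nat}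
    (A : 'I_m -> 'I_m -> 'M[R]_(p * q)) : 'M[R]_(m * p * q) :=
  castmx (sum_ord_constM m p q, sum_ord_constM m p q)
    (\mxblock_(i < m, j < m) A i j).

(* Main.v *)
From HB Require Import structures.
Require Import Defs.
From mathcomp Require Import all_boot all_order all_algebra.
From mathcomp Require Import mxtens.
From mathcomp Require Import all_classical all_reals all_analysis measurable_realfun.

(** The stacked matrix, once vectorised, is an affine function of [vec Y]: by
    [vec (A Y C) = (A (x) C') vec Y], block [i] is [G_i vec Y + vec rho_i] with
    [G_i = kappa_i (x) iota_i' + alpha_i (x) beta_i'], and stacking rows of
    blocks is compatible with row-by-row vectorisation ([vec_stack_mx]).
    Expanding [G_i Lambda G_j'] gives the four terms of [A_ij].

    What remains is that an affine map [x |-> M x + b] sends a normal vector of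
    parameters [(mu, S)] to one of parameters [(M mu + b, M S M')]
    ([normal_vector_affine]).  A linear form of [M X + b] is a linear form of
    [X] plus a constant, so normality of its law is invariance of the family of
    normal laws under translations ([is_normal_shift]), which rests on that of
    the Lebesgue measure.  The mean and the covariance are computed by
    (bi)linearity, which is available once the coordinates are known to be
    square integrable; that follows from the finiteness of their variances
    ([fin_num_variance_Lfun2]). *)

Import Order.TTheory GRing.Theory Num.Theory.

Local Open Scope ring_scope.

Lemma measurable_shift {R : realType} (c : R) :
  measurable_fun [set: measurableTypeR R]
    ((fun x => x + c) : measurableTypeR R -> measurableTypeR R).
Proof. exact: measurable_funD. Qed.

(** The Lebesgue measure is determined by its values on half-open intervals,
    where invariance is the invariance of the length. *)
Lemma lebesgue_measure_shift {R : realType} (c : R) (A : set R) :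
  measurable A ->
  pushforward lebesgue_measure ((fun x => x + c) : _ -> measurableTypeR R) A
  = lebesgue_measure A.
Proof.
move=> mA; pose sh : measurableTypeR R -> measurableTypeR R := fun x => x + c.
have msh : measurable_fun setT sh := measurable_shift c.
pose shm : {mfun _ >-> _} := HB.pack sh (isMeasurableFun.Build _ _ _ _ _ msh).
apply/esym/(lebesgue_measure_unique (mu := pushforward lebesgue_measure shm)) => //=.
move=> _ [[a b]] _ <-.
rewrite /pushforward /=.
rewrite [X in _ = lebesgue_measure X](_ : _ = `](a - c), (b - c)]%classic).
  by rewrite !lebesgue_measure_itv /= !lte_fin ltrD2r -!EFinB opprB addrA subrK.
by apply/seteqP; split => x /=; rewrite !in_itv /= ltrBlDr lerBrDr.
Qed.

(** The density of mean [m] at [x] is that of mean [m + c] at [x + c]; the rest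
    is the change of variable [y = x + c]. *)
Lemma normal_prob_shift {R : realType} (m s c : R)
    (A : set (measurableTypeR R)) : s != 0 -> measurable A ->
  normal_prob m s ((fun x => x + c) @^-1` A)%classic = normal_prob (m + c) s A.
Proof.
move=> s0 mA; rewrite /normal_prob.
pose f (y : measurableTypeR R) := (normal_pdf (m + c) s y)%:E.
have mf : measurable_fun setT f.
  by apply/measurable_EFinP; exact: measurable_normal_pdf.
pose sh : measurableTypeR R -> measurableTypeR R := fun x => x + c.
have msh : measurable_fun setT sh := measurable_shift c.
pose shm : {mfun _ >-> _} := HB.pack sh (isMeasurableFun.Build _ _ _ _ _ msh).
under eq_integral => x _.
  rewrite (_ : _%:E = (f \o sh) x); last first.
    rewrite /f /= !normal_pdfE // /normal_fun.
    by rewrite [m + c]addrC opprD addrA addrK.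
  over.
rewrite -(ge0_integral_pushforward msh) //=; last 2 first.
- exact: measurable_funTS.
- by move=> y _; rewrite lee_fin normal_pdf_ge0.
apply/esym/(eq_measure_integral (pushforward lebesgue_measure shm)) => //= B mB _.
exact/esym/lebesgue_measure_shift.
Qed.

Lemma normal_law_shift {R : realType} (m s c : R)
    (A : set (measurableTypeR R)) : measurable A ->
  normal_law m s ((fun x => x + c) @^-1` A)%classic = normal_law (m + c) s A.
Proof.
(* For [s = 0] both sides are the indicator of [m + c] belonging to [A]. *)
move=> mA; rewrite /normal_law; have [_|s0] := eqVneq s 0; first by [].
exact: normal_prob_shift.
Qed.

Lemma is_normal_shift {d : measure_display} {T : measurableType d}
    {R : realType} (P : probability T R) (X : T -> R) (c : R) :
  is_normal P X -> is_normal P (fun w => X w + c).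
Proof.
move=> [mX [m [s [s0 lawX]]]]; split; first exact: measurable_funD.
exists (m + c), s; split=> [|A mA]; first exact: s0.
rewrite -(normal_law_shift _ _ _ _ mA) -lawX; first by [].
by rewrite -[X in measurable X]setTI; exact: measurable_shift.
Qed.

(** The variance is the integral of the nonnegative function [(X - E X)^2], so
    its finiteness puts [X - c] in L^2 for the constant [c = fine (E X)], and
    constants are in L^2. *)
Lemma fin_num_variance_Lfun2 {d : measure_display} {T : measurableType d}
    {R : realType} (P : probability T R) (X : T -> R) :
  measurable_fun setT X -> covariance P X X \is a fin_num ->
  X \in Lfun P 2%:E.
Proof.
move=> mX; rewrite unlock expectation.unlock; set c := fine _ => finV.
have L2D : X \- cst c \in Lfun P 2%:E.
  apply/andP; split; rewrite inE /=; first exact: measurable_funB.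
  rewrite /finite_norm unlock /Lnorm poweR_lty //.
  move: finV; rewrite fin_numE => /andP[_]; rewrite -ltey => /le_lt_trans; apply.
  rewrite le_eqVlt; apply/orP; left; apply/eqP/eq_integral => w _ /=.
  by rewrite powR_mulrn // real_normK ?num_real // expr2.
rewrite (_ : X = (X \- cst c) + cst c); last by apply/funext => w; rewrite !fctE subrK.
by apply: rpredD => //; [exact: lee1n | move=> ?; exact: Lfun_cst].
Qed.

Lemma Lfun2_addr_closed {d : measure_display} {T : measurableType d}
    {R : realType} (P : probability T R) : addr_closed (Lfun P 2%:E).
Proof. by apply: Lfun_addr_closed; exact: lee1n. Qed.

Lemma lincomb_fctE {T : Type} {R : realType} (I : finType) (a : I -> R)
    (X : I -> T -> R) (b : R) :
  (fun w => \sum_i a i * X i w + b) = \sum_i (a i \o* X i) \+ cst b.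
Proof.
apply/funext => w; rewrite !fctE fct_sumE.
by congr (_ + _); apply: eq_bigr => i _ /=; rewrite mulrC.
Qed.

Lemma Lfun2_lincomb {d : measure_display} {T : measurableType d}
    {R : realType} (P : probability T R) (I : finType) (a : I -> R)
    (X : I -> T -> R) (b : R) :
  (forall i, X i \in Lfun P 2%:E) ->
  (fun w => \sum_i a i * X i w + b) \in Lfun P 2%:E.
Proof.
move=> X2; have [L0 LD] := Lfun2_addr_closed P.
rewrite lincomb_fctE.
apply: (LD _ (cst b)); last exact: Lfun_cst.
apply: (big_ind (fun f => f \in Lfun P 2%:E)); [exact: L0|exact: LD|move=> i _].
by apply: Lfun_scale; rewrite ?ler1n.
Qed.

(** Common source of the formulas for [E] and for [covariance _ Z]: both
    functionals are linear on L^2 only, so that membership in L^2 has to be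
    carried along the sum. *)
Lemma functional_lincomb {d : measure_display} {T : measurableType d}
    {R : realType} (P : probability T R) (L : (T -> R) -> \bar R)
    (I : finType) (a : I -> R) (X : I -> T -> R) (b : R) (l : I -> R) (k : R) :
  {in Lfun P 2%:E &, forall f g : T -> R, L (f \+ g) = (L f + L g)%E} ->
  {in Lfun P 2%:E, forall (f : T -> R) c, L (c \o* f) = (c%:E * L f)%E} ->
  (forall i, X i \in Lfun P 2%:E) ->
  (forall i, L (X i) = (l i)%:E) -> L (cst b) = k%:E ->
  L (fun w => \sum_i a i * X i w + b) = (\sum_i a i * l i + k)%:E.
Proof.
move=> LfunD LfunZ X2 LX Lb; have [L0 LD] := Lfun2_addr_closed P.
rewrite lincomb_fctE.
(* [L 0 = 0], the base case, is homogeneity with the scalar 0. *)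
have [S2 LS] : \sum_i (a i \o* X i) \in Lfun P 2%:E /\
    L (\sum_i (a i \o* X i)) = (\sum_i a i * l i)%:E.
  elim/big_rec2: _ => [|i s f _ [f2 Lf]].
    split=> //.
    rewrite (_ : 0 = 0 \o* 0) ?LfunZ ?mul0e //.
    by apply/funext => w /=; rewrite mulr0.
  have aX2 : a i \o* X i \in Lfun P 2%:E by apply: Lfun_scale; rewrite ?ler1n.
  by split; [exact: LD | rewrite [L _]LfunD // LfunZ // LX Lf].
by rewrite LfunD ?LS ?Lb //; exact: Lfun_cst.
Qed.

Lemma expectation_lincomb {d : measure_display} {T : measurableType d}
    {R : realType} (P : probability T R) (I : finType) (a : I -> R)
    (X : I -> T -> R) (b : R) (mu : I -> R) :
  (forall i, X i \in Lfun P 2%:E) ->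
  (forall i, expectation P (X i) = (mu i)%:E) ->
  expectation P (fun w => \sum_i a i * X i w + b)
  = (\sum_i a i * mu i + b)%:E.
Proof.
move=> X2 EX.
have L1 f : f \in Lfun P 2%:E -> f \in Lfun P 1.
  by apply: Lfun_subset12; exact: fin_num_measure.
apply: functional_lincomb X2 EX _ => [f g f2 g2|f f2 c|].
- by rewrite expectationD ?L1.
- by rewrite expectationZl ?L1.
- exact: expectation_cst.
Qed.

Lemma covariance_lincombl {d : measure_display} {T : measurableType d}
    {R : realType} (P : probability T R) (I : finType) (a : I -> R)
    (X : I -> T -> R) (b : R) (Z : T -> R) (s : I -> R) :
  (forall i, X i \in Lfun P 2%:E) -> Z \in Lfun P 2%:E ->
  (forall i, covariance P (X i) Z = (s i)%:E) ->
  covariance P (fun w => \sum_i a i * X i w + b) Z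
  = (\sum_i a i * s i)%:E.
Proof.
move=> X2 Z2 CXZ; rewrite -[X in X%:E]addr0.
have L1 f : f \in Lfun P 2%:E -> f \in Lfun P 1.
  by apply: Lfun_subset12; exact: fin_num_measure.
apply: (functional_lincomb P (covariance P ^~ Z)) X2 CXZ _ => [f g f2 g2|f f2 c|].
- by rewrite covarianceDl.
- by apply: covarianceZl; [exact: L1 | exact: L1 | exact: Lfun2_mul_Lfun1].
- exact: covariance_cst_l.
Qed.

(** The form [c' (M X + b)] is [(M' c)' X] plus a constant; nonnegativity of
    [M S M'] at [c] is likewise that of [S] at [M' c]. *)
Lemma normal_vector_affine {d : measure_display} {T : measurableType d}
    {R : realType} (P : probability T R) (n k : nat) (X : T -> 'cV[R]_n)
    (mu : 'cV[R]_n) (S : 'M[R]_n) (M : 'M[R]_(k, n)) (b : 'cV[R]_k) :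
  normal_vector P X mu S ->
  normal_vector P (fun w => M *m X w + b) (M *m mu + b) (M *m S *m M^T).
Proof.
move=> [Xnormal EX CX [Ssym Spos]].
have X2 i : (fun w => X w i 0) \in Lfun P 2%:E.
  apply: fin_num_variance_Lfun2; last by rewrite CX.
  (* The i-th coordinate is the linear form given by the i-th basis vector. *)
  have [mXi _] := Xnormal (delta_mx i 0).
  apply: eq_measurable_fun mXi => w _ /=.
  by rewrite trmx_delta -rowE mxE.
have coordE i : (fun w => (M *m X w + b) i 0)
    = (fun w => \sum_j M i j * X w j 0 + b i 0).
  by apply/funext => w; rewrite !mxE.
split.
- move=> c.
  rewrite (_ : (fun w => _) =
      (fun w => ((M^T *m c)^T *m X w) 0 0 + (c^T *m b) 0 0)).
    exact: is_normal_shift.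
  by apply/funext => w; rewrite mulmxDr mxE trmx_mul trmxK mulmxA.
- by move=> i; rewrite coordE (expectation_lincomb _ _ _ _ _ _ X2 EX) !mxE.
(* Linearity in the first variable is used twice, through the symmetry of the
   covariance: first [Cov (X_l, (M X + b)_j) = (S M')_lj], then the claim. *)
- move=> i j; have Z2 : (fun w => (M *m X w + b) j 0) \in Lfun P 2%:E.
    by rewrite coordE; exact: Lfun2_lincomb.
  have CXZ l : covariance P (fun w => X w l 0) (fun w => (M *m X w + b) j 0)
      = ((S *m M^T) l j)%:E.
    have CX' r : covariance P (fun w => X w r 0) (fun w => X w l 0)
        = (S l r)%:E by rewrite covarianceC.
    rewrite covarianceC coordE (covariance_lincombl _ _ _ _ _ _ _ X2 (X2 l) CX').
    by rewrite mxE; congr EFin; apply: eq_bigr => r _; rewrite mxE mulrC.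
  rewrite (coordE i) (covariance_lincombl _ _ _ _ _ _ _ X2 Z2 CXZ).
  by rewrite -mulmxA [in RHS]mxE.
- split; first by rewrite !trmx_mul trmxK Ssym mulmxA.
  move=> c; have := Spos (M^T *m c).
  by rewrite trmx_mul trmxK !mulmxA.
Qed.

(** Reading entries at [Rank i a] avoids the dependent pair of block number and
    position inside the block in terms of which [\mxcol] is defined. *)
Lemma mxcol_Rank {R : Type} {m n : nat} {r : 'I_m -> nat}
    (B : forall i, 'M[R]_(r i, n)) (i : 'I_m) (a : 'I_(r i)) (j : 'I_n) :
  (\mxcol_i B i) (tagnat.Rank i a) j = B i a j.
Proof. by have /matrixP/(_ a j) := mxcolK B i; rewrite mxE. Qed.

(** Both sides list, block after block, the rows of each block: entry [(a, b)]
    of block [i] has rank [(i p + a) q + b = i (p q) + (a q + b)]. *)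
Lemma vec_stack_mx {R : Type} {m p q : nat} (B : 'I_m -> 'M[R]_(p, q)) :
  vec (stack_mx B)
  = castmx (sum_ord_constM m p q, erefl 1%N) (\mxcol_(i < m) vec (B i)).
Proof.
apply: (canRL (castmxKV _ _)) => /=.
apply/colP => k; rewrite -(tagnat.sig2K k).
move: (tagnat.sig1 k) (tagnat.sig2 k) => i s {k}.
case/mxvec_indexP: s => a b.
rewrite mxcol_Rank castmxE /= cast_ord_id /vec !mxE mxvecE.
rewrite (_ : cast_ord _ _ =
  mxvec_index (cast_ord (sum_ord_const m p) (tagnat.Rank i a)) b).
  by rewrite mxvecE castmxE cast_ordK cast_ord_id mxcol_Rank.
apply: val_inj; rewrite [mxvec_index (cast_ord _ _) b]mxvec_indexE.
have RankE (r : nat) (c : 'I_r) :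
    val (tagnat.Rank (p_ := fun=> r) i c) = (\sum_(k < m | k < i) r + c)%N.
  exact: tagnat.RankEsum.
transitivity (\sum_(k < m | k < i) p * q + (a * q + b))%N.
  by rewrite [LHS]RankE mxvec_indexE.
rewrite addnA -big_distrl -mulnDl.
by congr (_ * q + b)%N; exact/esym/RankE.
Qed.

Lemma castmx_congruence {R : pzSemiRingType} {n n' k : nat} (e : n = n')
    (G : 'M[R]_(n, k)) (L : 'M[R]_k) :
  castmx (e, erefl k) G *m L *m (castmx (e, erefl k) G)^T
  = castmx (e, e) (G *m L *m G^T).
Proof. by case: _ / e; rewrite !castmx_id. Qed.

Lemma castmx_affine {R : pzSemiRingType} {n n' k l : nat} (e : n = n')
    (G : 'M[R]_(n, k)) (H : 'M[R]_(k, l)) (B : 'M[R]_(n, l)) :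
  castmx (e, erefl k) G *m H + castmx (e, erefl l) B
  = castmx (e, erefl l) (G *m H + B).
Proof. by case: _ / e; rewrite !castmx_id. Qed.

Theorem lemmaA1 (R : realType) (d : measure_display) (T : measurableType d)
    (P : probability T R) (p q m : nat)
    (Y : T -> 'M[R]_(p, q)) (Lambda : 'M[R]_(p * q))
    (kappa alpha : 'I_m -> 'M[R]_p) (iota beta : 'I_m -> 'M[R]_q)
    (rho : 'I_m -> 'M[R]_(p, q)) :
  matrix_normal P Y 0 Lambda ->
  let A (i j : 'I_m) : 'M[R]_(p * q) :=
    (kappa i *t (iota i)^T) *m Lambda *m ((kappa j)^T *t iota j)
    + (kappa i *t (iota i)^T) *m Lambda *m ((alpha j)^T *t beta j)
    + (alpha i *t (beta i)^T) *m Lambda *m ((kappa j)^T *t iota j)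
    + (alpha i *t (beta i)^T) *m Lambda *m ((alpha j)^T *t beta j) in
  (forall i j : 'I_m, A j i = (A i j)^T) /\
  matrix_normal P
    (fun w => stack_mx (fun i : 'I_m =>
       kappa i *m Y w *m iota i + alpha i *m Y w *m beta i + rho i))
    (stack_mx rho) (blocks_mx A).
Proof.
move=> Ynormal A.
pose G i := kappa i *t (iota i)^T + alpha i *t (beta i)^T.
have AE i j : A i j = G i *m Lambda *m (G j)^T.
  rewrite /A /G linearD /= !trmx_tens !trmxK.
  by rewrite mulmxDl [in RHS]mulmxDl !mulmxDr !addrA.
have [_ _ _ [Lsym _]] := Ynormal.
split; first by move=> i j; rewrite !AE !trmx_mul trmxK Lsym mulmxA.
pose M := castmx (sum_ord_constM m p q, erefl (p * q)%N) (\mxcol_(i < m) G i).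
have vecD (a b : nat) (U V : 'M[R]_(a, b)) : vec (U + V) = vec U + vec V.
  by rewrite /vec !linearD.
have stackE : (fun w => vec (stack_mx (fun i : 'I_m =>
      kappa i *m Y w *m iota i + alpha i *m Y w *m beta i + rho i)))
    = (fun w => M *m vec (Y w) + vec (stack_mx rho)).
  apply/funext => w; rewrite !vec_stack_mx castmx_affine mxcol_mul -mxcolD.
  congr castmx; apply: eq_mxcol => i.
  by rewrite !vecD !vec_mulmx mulmxDl.
have meanE : vec (stack_mx rho) = M *m vec 0 + vec (stack_mx rho).
  by rewrite [vec 0]/vec linear0 trmx0 mulmx0 add0r.
have covE : blocks_mx A = M *m Lambda *m M^T.
  rewrite castmx_congruence mxcol_mul tr_mxcol mul_mxcol_mxrow.
  by congr castmx; apply: eq_mxblock => i j; exact: AE.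
rewrite /matrix_normal stackE [X in normal_vector _ _ X]meanE covE.
exact: normal_vector_affine.
Qed.
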